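(* For every integer $k\ge 8$ there exist a non-negative integer $\ell<\binom{k}{2}$ and a $(k-1)$-colorable graph $G$ such that $G$ is a $B+E_\ell$ graph and $\mathrm{Kc}(G,k)\ge 2$. Furthermore, for every integer $k\ge 12$ there exists a $(k-1)$-colorable graph $G_k$ with $\mathrm{Kc}(G_k,k)\ge 2$ such that $G_k$ is a $B+E_\ell$ graph with $\ell=\left(k^2+8k-45+\mathbf{1}_{k-1}\right)/4$.
   Context: Graphs are finite and simple. For a positive integer $k$, a (proper) $k$-coloring of a graph $G$ assigns to each vertex a color from $\{1,\ldots,k\}$ so that adjacent vertices receive distinct colors (not all colors need be used); $G$ is $k$-colorable if it has a $k$-coloring. Given a $k$-coloring $\varphi$ and two distinct colors $i,j\in\{1,\ldots,k\}$, an $i,j$-Kempe swap interchanges the colors $i$ and $j$ on some connected component of the subgraph induced by the vertices colored $i$ or $j$ under $\varphi$; this yields another proper $k$-coloring. Two $k$-colorings of $G$ are equivalent if one can be transformed into the other by a (finite, possibly empty) sequence of Kempe swaps, all intermediate colorings being $k$-colorings. $\mathrm{Kc}(G,k)$ denotes the number of equivalence classes of $k$-colorings of $G$. A graph $G$ is a $B+E_\ell$ graph (written $G=B+E_\ell$) if it is formed from some bipartite graph $B$ by adding $\ell$ edges, i.e. $G$ has a bipartite spanning subgraph $B$ with $|E(G)|-|E(B)|=\ell$. For a positive integer $x$, $\mathbf{1}_x$ equals $1$ if $x$ is odd and $0$ if $x$ is even. *)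

(* Defs.v *)
From mathcomp Require Import all_boot all_fingroup.

Set Implicit Arguments.
Unset Strict Implicit.
Unset Printing Implicit Defensive.

Record sgraph (V : finType) := SGraph {
  adj :> rel V;
  adj_sym : symmetric adj;
  adj_irr : irreflexive adj
}.

Definition edges (V : finType) (G : sgraph V) : {set {set V}} :=
  [set [set p.1; p.2] | p : V * V & G p.1 p.2].

(* The colors 1, ..., k are represented by 'I_k, that is, by 0, ..., k - 1. *)
Definition proper_coloring (V : finType) (G : sgraph V) (k : nat)
    (phi : {ffun V -> 'I_k}) : bool :=
  [forall x, forall y, G x y ==> (phi x != phi y)].

Definition coloring (V : finType) (G : sgraph V) (k : nat) : finType :=
  {phi : {ffun V -> 'I_k} | proper_coloring G phi}.

Definition colorable (V : finType) (G : sgraph V) (k : nat) : Prop :=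
  exists phi : {ffun V -> 'I_k}, proper_coloring G phi.

Definition bipartite (V : finType) (B : sgraph V) : Prop :=
  exists A : {set V}, forall x y, B x y -> (x \in A) != (y \in A).

(* [B] lives on the vertex type of [G], hence it is a spanning subgraph. *)
Definition BplusE (V : finType) (G : sgraph V) (l : nat) : Prop :=
  exists B : sgraph V,
    [/\ bipartite B, subrel B G & #|edges G| = #|edges B| + l].

Definition two_colored_adj (V : finType) (G : sgraph V) (k : nat)
    (phi : {ffun V -> 'I_k}) (i j : 'I_k) : rel V :=
  [rel x y | [&& phi x \in [set i; j], phi y \in [set i; j] & G x y]].

(* For a vertex [x] colored [i] or [j], this is the component of [x] in the
   subgraph induced by the vertices colored [i] or [j]. *)
Definition kempe_chain (V : finType) (G : sgraph V) (k : nat)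
    (phi : {ffun V -> 'I_k}) (i j : 'I_k) (x : V) : {set V} :=
  [set y | connect (two_colored_adj G phi i j) x y].

Definition kempe_swap (V : finType) (k : nat) (phi : {ffun V -> 'I_k})
    (i j : 'I_k) (C : {set V}) : {ffun V -> 'I_k} :=
  [ffun v => if v \in C then tperm i j (phi v) else phi v].

Definition kempe_step (V : finType) (G : sgraph V) (k : nat) :
    rel (coloring G k) :=
  [rel phi psi : coloring G k |
    [exists i : 'I_k, exists j : 'I_k, exists x : V,
      [&& i != j, val phi x \in [set i; j] &
          val psi == kempe_swap (val phi) i j
                       (kempe_chain G (val phi) i j x)]]].

Definition kempe_equiv (V : finType) (G : sgraph V) (k : nat) :
    rel (coloring G k) :=
  connect (@kempe_step V G k).

Definition Kc (V : finType) (G : sgraph V) (k : nat) : nat :=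
  #|equivalence_partition (@kempe_equiv V G k) [set: coloring G k]|.

(* Main.v *)
Require Import Defs.
From mathcomp Require Import all_boot all_fingroup zify.

(** A coloring is frozen when any two of its color classes induce a connected
    subgraph.  A Kempe swap of a frozen coloring only renames colors, so its
    Kempe class consists of the colorings with the same color classes
    ([frozen_equiv]).  Hence a graph with a frozen [k]-coloring and a
    [k]-coloring with other color classes has at least two Kempe classes.

    The graph, for [k = 4 + n], has nine grid vertices [(b, c)] with [b] and [c]
    in [{0, 1, 2}], and [n] singleton vertices that are adjacent to every other
    vertex.  The rows of the grid are the classes of a coloring by three colors.
    A second coloring uses four: one color for the diagonal, the hub color, and
    one for the off-diagonal part of each column. Two grid vertices are adjacent
    when both colorings tell them apart; giving each singleton vertex a color of
    its own turns these into a coloring by [k - 1] colors and one by [k] colors.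
    A row meets each of the four classes in at most one vertex, so the edges
    missing between two of these classes form a matching, and no more than one
    edge is missing between two classes of size two.  This is why the second
    coloring is frozen ([frozen_color_center]).

    The number of edges inside the parts of a bipartition of the vertices is
    small when both parts have nearly the same size and no non-edge is lost to
    the cut.  All non-edges lie in the grid, so the grid is kept on one side.
    There are [15] of them, so parts of sizes [p] and [q] leave exactly
    ['C(p, 2) + 'C(q, 2) - 15] edges uncut ([BplusE_grid]).  With the grid alone
    on its side this is ['C(9, 2) + 'C(n, 2) - 15], which is below ['C(k, 2)] as
    soon as [k] is at least [8].  Balanced parts give the second bound; the
    grid fits into a half of the [n + 9] vertices from [k = 12] on. *)

Set Implicit Arguments.
Unset Strict Implicit.
Unset Printing Implicit Defensive.

(** * Frozen colorings *)

Definition frozen (V : finType) (G : sgraph V) k (phi : {ffun V -> 'I_k}) :=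
  forall i j x y, i != j -> phi x \in [set i; j] -> phi y \in [set i; j] ->
    connect (two_colored_adj G phi i j) x y.

Lemma two_colored_sym (V : finType) (G : sgraph V) k (phi : {ffun V -> 'I_k})
    i j : connect_sym (two_colored_adj G phi i j).
Proof.
apply: sym_connect_sym => x y; rewrite /two_colored_adj /= (adj_sym G).
by case: (phi x \in _); case: (phi y \in _).
Qed.

(** A vertex within distance two of all vertices colored in [K], inside the
    subgraph that they induce.  Radius two is enough for all pairs of classes
    of the graph below, and it keeps the case analysis free of longer paths. *)
Definition center (V : finType) (G : sgraph V) k (phi : V -> 'I_k)
    (K : {set 'I_k}) (z : V) :=
  phi z \in K /\ forall x, phi x \in K ->
    [\/ x = z, G x z | exists w, [/\ phi w \in K, G x w & G w z]].

Lemma frozen_center (V : finType) (G : sgraph V) k (phi : {ffun V -> 'I_k}) :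
  (forall i j, i != j -> exists z, center G phi [set i; j] z) -> frozen G phi.
Proof.
move=> has_center i j x y /has_center[z [zij near_z]] xij yij.
have link u v : phi u \in [set i; j] -> phi v \in [set i; j] -> G u v ->
    connect (two_colored_adj G phi i j) u v.
  by move=> uij vij uv; apply: connect1; rewrite /two_colored_adj /= uij vij.
have to_z u : phi u \in [set i; j] -> connect (two_colored_adj G phi i j) u z.
  move=> uij; case: (near_z u uij) => [-> | uz | [w [wij uw wz]]].
  - exact: connect0.
  - exact: link.
  - by apply: connect_trans (link w z _ _ _); first exact: link.
by apply: connect_trans (to_z x xij) _; rewrite two_colored_sym to_z.
Qed.

(** The Kempe chain of [x] is the union of the two classes, and [tperm i j]
    fixes all the other colors. *)
Lemma swap_frozen (V : finType) (G : sgraph V) k (phi : {ffun V -> 'I_k})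
    i j x :
    frozen G phi -> i != j -> phi x \in [set i; j] ->
  kempe_swap phi i j (kempe_chain G phi i j x) = [ffun v => tperm i j (phi v)].
Proof.
move=> frz ij xij; apply/ffunP=> v; rewrite !ffunE inE.
case: ifPn => // not_xv; case: tpermP => // vi; case/negP: not_xv;
  by apply: frz; rewrite // vi !inE eqxx ?orbT.
Qed.

Lemma frozen_perm (V : finType) (G : sgraph V) k (phi : {ffun V -> 'I_k})
    (s : {perm 'I_k}) :
  frozen G phi -> frozen G [ffun v => s (phi v)].
Proof.
move=> frz i j x y ij.
have mem_s v : (s (phi v) \in [set i; j]) = (phi v \in [set s^-1 i; s^-1 j]%g).
  by rewrite !inE !(canF_eq (permK s)).
rewrite !ffunE !mem_s => xij yij.
rewrite (eq_connect (e' := two_colored_adj G phi (s^-1 i)%g (s^-1 j)%g)).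
  by apply: frz; rewrite // (inj_eq perm_inj).
by move=> u v; rewrite /two_colored_adj /= !ffunE !mem_s.
Qed.

(** Frozenness survives every swap, because it depends on the color classes
    only; the renamings of the successive swaps compose to a permutation. *)
Lemma frozen_equiv (V : finType) (G : sgraph V) k (phi psi : coloring G k) :
    frozen G (val phi) -> kempe_equiv phi psi ->
  exists s : {perm 'I_k}, val psi = [ffun v => s (val phi v)].
Proof.
move=> frz /connectP[p + ->].
elim/last_ind: p => [_ | p chi IHp] /=.
  by exists 1%g; apply/ffunP=> v; rewrite ffunE perm1.
rewrite rcons_path last_rcons => /andP[/IHp[s]].
move: (last phi p) => theta def_theta.
case/existsP=> i /existsP[j /existsP[x /and3P[ij xij /eqP->]]].
rewrite swap_frozen // def_theta; last exact: frozen_perm.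
by exists (s * tperm i j)%g; apply/ffunP=> v; rewrite !ffunE permM.
Qed.

Lemma Kc_ge2 (V : finType) (G : sgraph V) k (phi psi : coloring G k) :
  ~~ kempe_equiv phi psi -> 2 <= Kc G k.
Proof.
move=> not_equiv.
pose cls (c : coloring G k) := [set d in setT | kempe_equiv c d].
rewrite -(_ : #|[set cls phi; cls psi]| = 2).
  apply: subset_leq_card; apply/subsetP=> C; rewrite !inE.
  by case/orP=> /eqP->; apply: imset_f; rewrite inE.
rewrite cards2; case: eqP => // /setP/(_ psi).
by rewrite !inE (negPf not_equiv) /kempe_equiv connect0.
Qed.

(** * Edges left uncut by a bipartition *)

(** An edge comes from two ordered pairs.  Counting ordered pairs turns the edge
    counts into sums over vertices. *)
Lemma card_edges (V : finType) (G : sgraph V) :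
  #|[set p : V * V | G p.1 p.2]| = (#|edges G|).*2.
Proof.
set P := [set p | _].
have -> : edges G = [set [set p.1; p.2] | p in P].
  apply/setP=> e; apply/imsetP/imsetP=> -[p Gp ->];
    by exists p; rewrite ?inE in Gp *.
rewrite -sum1_card (partition_big_imset (fun p => [set p.1; p.2])) /=.
rewrite -muln2 -sum_nat_const.
apply: eq_bigr => e /imsetP[[x y]]; rewrite inE /= => xy ->.
have neq_xy: x != y by apply: contraTneq xy => ->; rewrite (adj_irr G).
rewrite sum1_card -(_ : #|[set (x, y); (y, x)]| = 2); last first.
  by rewrite cards2 xpair_eqE negb_and neq_xy.
apply: eq_card => -[u v]; rewrite unfold_in /= !inE !xpair_eqE /=.
apply/andP/orP => /= [[uv /eqP/setP uvxy] | [] /andP[/eqP-> /eqP->]];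
  last 2 first.
- by [].
- by rewrite (adj_sym G) xy setUC.
have neq_uv: u != v by apply: contraTneq uv => ->; rewrite (adj_irr G).
have:= uvxy u; have:= uvxy v; rewrite !inE !eqxx orbT /=.
case: (v =P x) => [vx _ | _ /esym/eqP vy].
  by rewrite -vx (negPf neq_uv) /= => /esym->; right.
by rewrite -vy (negPf neq_uv) orbF eqxx => /esym->; left.
Qed.

(** The ordered pairs inside the parts, the diagonal included, number
    [#|S| ^ 2 + #|~: S| ^ 2].  When the cut separates no non-adjacent pair, they
    are the non-adjacent pairs together with two pairs for each uncut edge. *)
Lemma BplusE_cut (V : finType) (G : sgraph V) (S : {set V}) l :
    (forall x y, ~~ G x y -> (x \in S) = (y \in S)) ->
    #|S| ^ 2 + #|~: S| ^ 2 = l.*2 + #|[set p : V * V | ~~ G p.1 p.2]| ->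
  BplusE G l.
Proof.
move=> nonadjS countS.
pose r := [rel x y | G x y && ((x \in S) != (y \in S))].
have r_sym : symmetric r by move=> x y; rewrite /= (adj_sym G) eq_sym.
have r_irr : irreflexive r by move=> x; rewrite /= (adj_irr G).
exists (SGraph r_sym r_irr); split.
- by exists S => x y /andP[].
- by move=> x y /andP[].
apply: double_inj; rewrite doubleD -!card_edges /=.
set N := [set p | ~~ _] in countS; set E := [set p | G _ _].
set C := [set p | _ && _].
have sCE : C \subset E by apply/subsetP=> p; rewrite !inE => /andP[].
have cardSS : #|setX S S :|: setX (~: S) (~: S)| = #|S| ^ 2 + #|~: S| ^ 2.
  rewrite cardsU !cardsX !mulnn.
  rewrite (_ : _ :&: _ = set0) ?cards0 ?subn0 //.
  by apply/setP=> -[x y]; rewrite !inE /=; case: (x \in S); rewrite ?andbF.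
rewrite -(cardsID C E) (setIidPr sCE); congr (_ + _).
apply/eqP; rewrite -(eqn_add2r #|N|) -countS -cardSS.
rewrite -(_ : (E :\: C) :|: N = setX S S :|: setX (~: S) (~: S)).
  rewrite cardsU (_ : _ :&: N = set0) ?cards0 ?subn0 //.
  by apply/setP=> p; rewrite !inE; case: (G _ _); rewrite ?andbF.
apply/setP=> -[x y]; rewrite !inE /=.
have:= nonadjS x y.
by case: (G x y) => [_ | ->] //; case: (x \in S); case: (y \in S).
Qed.

(** * The graph *)

Section ConflictGraph.
Variables (V : finType) (C D : eqType) (f : V -> C) (g : V -> D).

Let conflict := [rel x y | (f x != f y) && (g x != g y)].

Fact conflict_sym : symmetric conflict.
Proof. by move=> x y /=; rewrite eq_sym [g x == _]eq_sym. Qed.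

Fact conflict_irr : irreflexive conflict.
Proof. by move=> x /=; rewrite eqxx. Qed.

(** The largest graph on [V] for which both [f] and [g] are proper colorings. *)
Definition conflict_graph : sgraph V := SGraph conflict_sym conflict_irr.

End ConflictGraph.

Section Construction.
Variable n : nat.

Notation vertex := ('I_3 * 'I_3 + 'I_n)%type.

(** The colors are [lshift n ord_max], the hub color of the diagonal;
    [lshift n (lift ord_max c)], the color of column [c]; and [rshift 4 s], the
    color of the singleton vertex [inr s]. *)
Definition frozen_color (v : vertex) : 'I_(4 + n) :=
  match v with
  | inl (b, c) => lshift n (if b == c then ord_max else lift ord_max c)
  | inr s => rshift 4 s
  end.

Definition row_color (v : vertex) : 'I_(3 + n) :=
  match v with inl (b, _) => lshift n b | inr s => rshift 3 s end.

Definition grid_graph := conflict_graph frozen_color row_color.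

Lemma frozen_coloringP : proper_coloring grid_graph (finfun frozen_color).
Proof.
by apply/forallP=> x; apply/forallP=> y; apply/implyP=> /andP[]; rewrite !ffunE.
Qed.

Lemma row_coloringP : proper_coloring grid_graph (finfun row_color).
Proof.
apply/forallP=> x; apply/forallP=> y; apply/implyP=> /andP[_].
by rewrite !ffunE.
Qed.

(** The coloring by rows among the [4 + n]-colorings, where Kempe equivalence
    compares it with [frozen_color]. *)
Definition wide_row_color (v : vertex) : 'I_(4 + n) :=
  widen_ord (leqnSn _) (row_color v).

Lemma wide_row_coloringP : proper_coloring grid_graph (finfun wide_row_color).
Proof.
apply/forallP=> x; apply/forallP=> y; apply/implyP=> /andP[_]; rewrite !ffunE.
by rewrite -!val_eqE.
Qed.

Lemma ord3_avoid2 (c d : 'I_3) : exists e : 'I_3, (e != c) && (e != d).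
Proof.
have /set0Pn[e]: ~: [set c; d] != set0.
  by rewrite -card_gt0 cardsCs setCK cards2 card_ord; case: (c != d).
by rewrite !inE negb_or; exists e.
Qed.

Lemma frozen_color_singleton v (s : 'I_n) :
  (frozen_color v == rshift 4 s) = (v == inr s).
Proof. by case: v => [[b c] | t] //=; rewrite ?eq_lrshift ?eq_rshift. Qed.

Lemma frozen_color_hub b c :
  (frozen_color (inl (b, c)) == lshift n ord_max) = (b == c).
Proof.
rewrite /= eq_lshift; case: (b == c); first by rewrite eqxx.
by rewrite eq_sym (negPf (neq_lift _ _)).
Qed.

Lemma frozen_color_column b c d :
  (frozen_color (inl (b, c)) == lshift n (lift ord_max d)) =
  (b != c) && (c == d).
Proof.
rewrite /= eq_lshift; case: (b == c); first by rewrite (negPf (neq_lift _ _)).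
by rewrite (inj_eq lift_inj).
Qed.

Lemma adj_grid b c b' c' :
  grid_graph (inl (b, c)) (inl (b', c')) =
  (b != b') && ~~ (((b == c) == (b' == c')) && ((b == c) || (c == c'))).
Proof.
rewrite /= !eq_lshift andbC; congr (_ && ~~ _).
by case: (b == c); case: (b' == c'); rewrite ?eqxx ?(inj_eq lift_inj) //=
  ?(negPf (neq_lift _ _)) // eq_sym (negPf (neq_lift _ _)).
Qed.

Lemma frozen_colorP (i : 'I_(4 + n)) :
  [\/ i = lshift n ord_max, exists c, i = lshift n (lift ord_max c)
     | exists s, i = rshift 4 s].
Proof.
case: (split_ordP i) => [h -> | s ->]; last by constructor 3; exists s.
by case: (unliftP ord_max h) => [c -> | ->];
  [constructor 2; exists c | constructor 1].
Qed.

(** A singleton vertex is adjacent to everything.  For the hub and column [c],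
    the center is the diagonal vertex [(c, c)]: it is adjacent to all of column
    [c], and [(b, b)] reaches it through [(e, c)], where [e] is the third row.
    For columns [c] and [d], the center is [(d, c)]: it is adjacent to all of
    column [d], and the other vertex of column [c] reaches it through [(c, d)],
    which no vertex of column [c] shares a row with. *)
Lemma frozen_color_center i j : i != j ->
  exists z, center grid_graph frozen_color [set i; j] z.
Proof.
have singleton h s :
    exists z, center grid_graph frozen_color [set h; rshift 4 s] z.
  exists (inr s); split=> [|x]; rewrite !inE ?eqxx ?orbT //.
  rewrite frozen_color_singleton.
  case: (x =P inr s) => [-> _ | /eqP xs _]; [by constructor 1 | constructor 2].
  rewrite /= frozen_color_singleton xs.
  by case: x xs => [[b c] | t]; rewrite /= ?eq_lrshift ?eq_rshift.
have hub_column c : exists z, center grid_graph frozen_color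
    [set lshift n ord_max; lshift n (lift ord_max c)] z.
  exists (inl (c, c)); split=> [|[[b d] | s]]; rewrite !inE.
  - by rewrite frozen_color_hub eqxx.
  - rewrite frozen_color_hub frozen_color_column adj_grid eqxx.
    case: (b =P d) => [<- _ | /eqP bd /= /eqP dc].
      case: (b =P c) => [-> | /eqP bc]; first by constructor 1.
      have [e /andP[eb ec]] := ord3_avoid2 b c.
      constructor 3; exists (inl (e, c)).
      rewrite !inE frozen_color_column !adj_grid ec !eqxx (negPf ec).
      by rewrite [b == e]eq_sym eb !andbT orbT.
    by constructor 2; rewrite -dc bd.
  - by rewrite !eq_rlshift.
have columns c d : c != d -> exists z, center grid_graph frozen_color
    [set lshift n (lift ord_max c); lshift n (lift ord_max d)] z.
  move=> cd; have dc: d != c by rewrite eq_sym.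
  exists (inl (d, c)); split=> [|[[b e] | s]]; rewrite !inE.
  - by rewrite frozen_color_column dc eqxx.
  - rewrite !frozen_color_column.
    case/orP=> /andP[be /eqP eE]; rewrite {}eE in be *.
      case: (b =P d) => [-> | /eqP bd]; first by constructor 1.
      constructor 3; exists (inl (c, d)).
      rewrite !inE !frozen_color_column !adj_grid cd be !eqxx.
      by rewrite (negPf cd) (negPf dc) (negPf be).
    by constructor 2; rewrite adj_grid be (negPf be) (negPf dc).
  - by rewrite !eq_rlshift.
case: (frozen_colorP j) => [-> | [d ->] | [t ->] _]; last exact: singleton.
- case: (frozen_colorP i) => [-> | [c ->] _ | [s ->] _].
  - by rewrite eqxx.
  - by rewrite setUC.
  - by rewrite setUC.
- case: (frozen_colorP i) => [-> _ | [c ->] cd | [s ->] _].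
  - exact: hub_column.
  - by apply: columns; apply: contraNneq cd => ->.
  - by rewrite setUC.
Qed.

(** The coloring by rows merges a diagonal vertex with an off-diagonal one. *)
Lemma Kc_grid_graph : 2 <= Kc grid_graph (4 + n).
Proof.
pose phi : coloring grid_graph (4 + n) :=
  exist (fun h => is_true (proper_coloring grid_graph h)) _ frozen_coloringP.
pose psi : coloring grid_graph (4 + n) :=
  exist (fun h => is_true (proper_coloring grid_graph h)) _ wide_row_coloringP.
have frz : frozen grid_graph (val phi).
  apply: frozen_center => i j /frozen_color_center[z [zij near_z]].
  exists z; split=> [|x]; rewrite ffunE //.
  case/near_z=> [-> | xz | [w [wij xw wz]]].
  - by constructor 1.
  - by constructor 2.
  - by constructor 3; exists w; rewrite ffunE.
apply: (@Kc_ge2 _ _ _ phi psi); apply/negP=> /(frozen_equiv frz)[s psiE].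
pose u : vertex := inl (ord0, ord0); pose v : vertex := inl (ord0, ord_max).
have: val psi u == val psi v by rewrite /= !ffunE.
by rewrite psiE !ffunE (inj_eq perm_inj) -val_eqE.
Qed.

Lemma nonadjacent_singleton x s : grid_graph x (inr s) = (x != inr s).
Proof.
case: x => [[b c] | t]; rewrite /= ?eq_lrshift ?eq_rshift //.
by rewrite andbb.
Qed.

(** These are the [9 + n] pairs [(x, x)] and two pairs for each of the [15]
    non-edges: [9] inside the rows, [3] on the diagonal, and [1] in the
    off-diagonal part of each column. *)
Lemma card_nonadjacent :
  #|[set p : vertex * vertex | ~~ grid_graph p.1 p.2]| = 39 + n.
Proof.
rewrite -sum1dep_card -(pair_big_dep xpredT (fun x y => ~~ grid_graph x y)
  (fun _ _ => 1)) big_sumType; congr (_ + _); last first.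
  rewrite -[RHS]card_ord -sum1_card; apply: eq_bigr => s _.
  rewrite (big_pred1 (inr s)) // => y.
  by rewrite (adj_sym grid_graph) nonadjacent_singleton negbK.
transitivity (\sum_(b < 3) \sum_(c < 3) \sum_(b' < 3) \sum_(c' < 3)
   ((b == b') || (((b == c) == (b' == c')) && ((b == c) || (c == c'))))).
  rewrite pair_bigA; apply: eq_bigr => -[b c] _.
  rewrite big_sumType -[RHS]addn0; congr (_ + _); last first.
    by rewrite big1 // => s; rewrite nonadjacent_singleton negbK.
  rewrite pair_bigA big_mkcond; apply: eq_bigr => -[b' c'] _.
  by rewrite adj_grid negb_and !negbK; case: (_ || _).
by rewrite !big_ord_recl !big_ord0.
Qed.

(** The part of the bipartition that contains the grid also contains the
    singleton vertices of [S]. *)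
Lemma BplusE_grid (S : {set 'I_n}) l :
    (9 + #|S|) ^ 2 + (n - #|S|) ^ 2 = l.*2 + (39 + n) -> BplusE grid_graph l.
Proof.
pose T := [set v : vertex | if v is inr s then s \in S else true].
have cardCT : #|~: T| = n - #|S|.
  have -> : n - #|S| = #|~: S| by rewrite [RHS]cardsCs setCK card_ord.
  rewrite -(card_imset _ (@inr_inj ('I_3 * 'I_3) 'I_n)).
  apply: eq_card => -[p | s]; rewrite !inE.
    by apply/esym/negP=> /imsetP[].
  by rewrite mem_imset ?inE //; apply: inr_inj.
have cardT : #|T| = 9 + #|S|.
  rewrite cardsCs cardCT card_sum card_prod !card_ord.
  by rewrite -addnBA ?leq_subr // subKn // -[n in _ <= n]card_ord max_card.
move=> countS; apply: (@BplusE_cut _ _ T).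
  move=> x y; case: y => [[b c] | s].
    case: x => [p | s]; first by rewrite !inE.
    by rewrite (adj_sym grid_graph) nonadjacent_singleton.
  by rewrite nonadjacent_singleton negbK => /eqP->.
by rewrite cardT cardCT countS card_nonadjacent.
Qed.

End Construction.

(** * Choice of the bipartition *)

(** Adding [n./2 - 4] singleton vertices to the grid makes a part of [n./2 + 5]
    vertices, half of the [n + 9] vertices rounded up; the truncated subtraction
    is exact because [n] is at least [8]. *)
Lemma balanced_count n : 8 <= n ->
  (9 + (n./2 - 4)) ^ 2 + (n - (n./2 - 4)) ^ 2 =
  (((4 + n) ^ 2 + 8 * (4 + n) - 45 + odd (4 + n - 1)) %/ 4).*2 + (39 + n).
Proof.
have [h [e ->]] : exists h (e : bool), n = e + h.*2.
  by exists n./2, (odd n); rewrite odd_double_half.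
rewrite half_bit_double => le8.
have -> : odd (4 + (e + h.*2) - 1) = ~~ e by lia.
(* The cofactor of [4] is 'C(h + 5, 2) + 'C(h + 4 + e, 2) - 15. *)
rewrite (_ : _ + ~~ e = (h ^ 2 + (8 + e) * h + 1 + 4 * e) * 4).
  by rewrite mulnK //; case: e le8; nia.
by case: e le8; nia.
Qed.

Theorem theorem1 :
  (forall k : nat, 8 <= k ->
     exists (l : nat) (V : finType) (G : sgraph V),
       [/\ l < 'C(k, 2), colorable G (k - 1), BplusE G l & 2 <= Kc G k])
  /\
  (forall k : nat, 12 <= k ->
     exists (V : finType) (G : sgraph V),
       [/\ colorable G (k - 1), 2 <= Kc G k &
           BplusE G ((k ^ 2 + 8 * k - 45 + odd (k - 1)) %/ 4)]).
Proof.
have bin2_double m : ('C(m, 2)).*2 = m * m.-1.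
  elim: m => // m IHm; rewrite binS bin1 doubleD IHm.
  by case: m {IHm} => // m; nia.
split=> k lek; have [n kE] : exists n, k = 4 + n by exists (k - 4); lia.
  rewrite {k}kE in lek *.
  (* The grid alone is one part; [21] is the number of its edges. *)
  exists (21 + 'C(n, 2)), _, (grid_graph n); split.
  - by rewrite -ltn_double doubleD !bin2_double; case: n lek => // n; nia.
  - by exists (finfun (@row_color n)); apply: row_coloringP.
  - apply: (@BplusE_grid _ set0); rewrite cards0 subn0.
    by rewrite doubleD bin2_double; case: n lek => // n; nia.
  - exact: Kc_grid_graph.
rewrite {k}kE in lek *; exists _, (grid_graph n); split.
- by exists (finfun (@row_color n)); apply: row_coloringP.
- exact: Kc_grid_graph.
have le_half : n./2 - 4 <= n by lia.
pose S := [set widen_ord le_half s | s in 'I_(n./2 - 4)].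
have cardS : #|S| = n./2 - 4.
  by rewrite card_imset ?card_ord // => s t /(congr1 val) /= /val_inj.
by apply: (@BplusE_grid _ S); rewrite cardS; apply: balanced_count.
Qed.
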